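(* For every $m\ge 1$, $\sup(\Lambda_{2m}^m)\ge \lceil (3m^2-2m+1)/2\rceil$; that is, every matrix in $\Lambda_{2m}^m$ has a critical set of size at least $\lceil (3m^2-2m+1)/2\rceil$.
   Context: $\Lambda_{n}^{x}$ is the set of $n\times n$ $(0,1)$-matrices with every row sum and every column sum equal to $x$. A matrix $M$ is identified with the set of triples $\{(i,j,M_{ij})\}$. A subset $D\subseteq M$ is a defining set for $M$ if $M$ is the unique element of $\Lambda_{2m}^m$ containing $D$; a critical set is a defining set none of whose proper subsets is a defining set; its size is its number of triples. For $M\in\Lambda_{2m}^m$, $\mathrm{lcs}(M)$ is the largest size of a critical set of $M$, and $\sup(\Lambda_{2m}^m)=\min\{\mathrm{lcs}(M): M\in\Lambda_{2m}^m\}$. *)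

(* Defs.v *)
From mathcomp Require Import all_boot all_algebra.

Set Implicit Arguments.
Unset Strict Implicit.
Unset Printing Implicit Defensive.

(* A (0,1)-matrix is a boolean matrix; row and column sums are taken in nat
   through the coercion false |-> 0, true |-> 1. *)
Definition Lambda (n x : nat) : {set 'M[bool]_n} :=
  [set M : 'M[bool]_n |
     [forall i, (\sum_(j < n) (M i j : nat))%N == x]
  && [forall j, (\sum_(i < n) (M i j : nat))%N == x]].

Definition triples (n : nat) (M : 'M[bool]_n) : {set 'I_n * 'I_n * bool} :=
  [set (i, j, M i j) | i in 'I_n, j in 'I_n].

Definition defining_set (n x : nat) (M : 'M[bool]_n)
    (D : {set 'I_n * 'I_n * bool}) : bool :=
  [&& M \in Lambda n x, D \subset triples M &
      [forall M' in Lambda n x, (D \subset triples M') ==> (M' == M)]].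

Definition critical_set (n x : nat) (M : 'M[bool]_n)
    (D : {set 'I_n * 'I_n * bool}) : bool :=
  defining_set x M D
  && [forall D' : {set 'I_n * 'I_n * bool},
        (D' \proper D) ==> ~~ defining_set x M D'].

(* For M in Lambda n x the maximum is over a nonempty family, since triples M
   is itself a defining set. *)
Definition lcs (n x : nat) (M : 'M[bool]_n) : nat :=
  \max_(D : {set 'I_n * 'I_n * bool} | critical_set x M D) #|D|.

(* The neutral value n ^ 2 is the number of triples of M, hence an upper bound
   of lcs x M: it does not affect the minimum as soon as Lambda n x is
   nonempty, see supLambda_attained and supLambda_le. *)
Definition supLambda (n x : nat) : nat :=
  \big[minn/n ^ 2]_(M in Lambda n x) lcs x M.

Lemma lcs_le (n x : nat) (M : 'M[bool]_n) : lcs x M <= n ^ 2.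
Proof.
apply/bigmax_leqP => D /andP[/and3P[_ sDM _] _].
apply: leq_trans (subset_leq_card sDM) _.
have sT : triples M \subset
    [set (p.1, p.2, M p.1 p.2) | p : 'I_n * 'I_n].
  by apply/subsetP => _ /imset2P[i j _ _ ->]; apply/imsetP; exists (i, j).
apply: leq_trans (subset_leq_card sT) _.
by apply: leq_trans (leq_imset_card _ _) _; rewrite card_prod card_ord mulnn.
Qed.

Lemma supLambda_le (n x : nat) (M : 'M[bool]_n) :
  M \in Lambda n x -> supLambda n x <= lcs x M.
Proof.
move=> ML; rewrite /supLambda; have := mem_index_enum M.
elim: (index_enum _) => // M' r IH; rewrite inE big_cons.
case/predU1P => [<-|/IH le_r]; first by rewrite ML geq_minl.
by case: ifP => // _; apply: leq_trans (geq_minr _ _) le_r.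
Qed.

Lemma supLambda_attained (n x : nat) :
  Lambda n x != set0 ->
  exists2 M : 'M[bool]_n, M \in Lambda n x & supLambda n x = lcs x M.
Proof.
case/set0Pn => M0 M0L.
have [M ML Mmin] := arg_minnP (lcs x) M0L.
exists M => //; apply/eqP; rewrite eqn_leq supLambda_le //=.
rewrite /supLambda; elim/big_ind: _ => [|a b la lb|M' /Mmin //].
- exact: lcs_le.
- by rewrite leq_min la lb.
Qed.

Lemma Lambda_double_neq0 (m : nat) : Lambda (2 * m) m != set0.
Proof.
have cnt b k : \sum_(i < 2 * k) (odd i (+) b : nat) = k.
  rewrite mul2n -(big_mkord xpredT (fun i => odd i (+) b : nat)).
  elim: k => [|k IH]; first by rewrite big_nil.
  rewrite doubleS !big_nat_recr //= IH odd_double.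
  by case: b {IH}; rewrite ?addn0 addn1.
apply/set0Pn; exists (\matrix_(i < 2 * m, j < 2 * m) (odd i (+) odd j))%R.
rewrite inE; apply/andP; split; apply/forallP => i; apply/eqP.
- rewrite -[RHS](cnt (odd i)); apply: eq_bigr => j _.
  by rewrite mxE addbC.
- by rewrite -[RHS](cnt (odd i)); apply: eq_bigr => j _; rewrite mxE.
Qed.

(* Main.v *)
(* Read a matrix as an orientation of the complete bipartite graph on rows and
   columns, a 1 pointing from its row to its column and a 0 the other way: the
   row and column sums make every vertex balanced, and D is a defining set
   exactly when the arcs outside D form an acyclic digraph.  Hence, given a rank
   function on the vertices, some critical set avoids all rank-increasing arcs,
   and it must contain every arc that closes a cycle with increasing arcs.

   For a 1-entry (r, c) let [links r c] count the 1-entries (i, j) such that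
   (i, c) and (r, j) are 1-entries.  Ranking, in this order, the columns that
   point to r, then r, the other columns, the other rows pointing to c, then c,
   the other rows forces 2 m^2 - links r c arcs.  This is enough unless all
   [links] exceed m^2 / 2 + m - 1/2.  In that case take (y, z) with the largest
   number g of links, and a 4-cycle r -> c -> y -> z -> r.  Inserting y and z in
   the middle of the above ranking also forces the arcs i -> j for which
   i -> j -> y -> z -> i is a 4-cycle with i -> c and r -> j.  By Sidorenko's
   inequality for the 4-cycle, r and c can be chosen so that there are about
   g^3 / m^4 such arcs, which suffices by a one-variable inequality. *)
Require Import Defs.
From mathcomp Require Import all_boot all_order all_algebra zify.

Set Implicit Arguments.
Unset Strict Implicit.
Unset Printing Implicit Defensive.

(** * Orientations: cycles, rank functions and critical sets *)

Section Orientation.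
Variables (n x : nat) (M : 'M[bool]_n).

Local Notation vertex := ('I_n + 'I_n)%type.

Definition arc (u v : vertex) : bool :=
  match u, v with
  | inl i, inr j => M i j
  | inr j, inl i => ~~ M i j
  | _, _ => false
  end.

Definition free_arc (D : {set 'I_n * 'I_n * bool}) (u v : vertex) : bool :=
  match u, v with
  | inl i, inr j => M i j && ((i, j, true) \notin D)
  | inr j, inl i => ~~ M i j && ((i, j, false) \notin D)
  | _, _ => false
  end.

Definition forward_arc (rho : vertex -> nat) (u v : vertex) : bool :=
  arc u v && (rho u < rho v).

Lemma free_arcW D u v : free_arc D u v -> arc u v.
Proof. by case: u v => [i|j] [i'|j'] //= /andP[]. Qed.

Lemma sum_eq1 (j0 : 'I_n) : \sum_(j < n) (j0 == j : nat) = 1.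
Proof.
rewrite (bigD1 j0) //= eqxx big1 ?addn0 // => j.
by rewrite eq_sym => /negbTE ->.
Qed.

Lemma LambdaP : reflect ((forall i, \sum_(j < n) (M i j : nat) = x) /\
                         (forall j, \sum_(i < n) (M i j : nat) = x))
                        (M \in Lambda n x).
Proof.
rewrite inE; apply: (iffP andP) => -[].
  by move=> /forallP hr /forallP hc; split=> i; apply/eqP.
by move=> hr hc; split; apply/forallP => i; apply/eqP.
Qed.

(** Reversing a cycle keeps every vertex balanced: a vertex on it trades one outgoing arc for one
    incoming arc. The last clause records that only arcs of the cycle are flipped. *)
Lemma switch_cycle (p : seq vertex) :
    M \in Lambda n x -> uniq p -> cycle arc p -> p != [::] ->
  exists M' : 'M[bool]_n,
    [/\ M' \in Lambda n x, M' != M &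
        forall i j, M' i j != M i j ->
          if M i j then next p (inl i) == inr j else next p (inr j) == inl i].
Proof.
move=> /LambdaP[hr hc] up cp p0.
(* [N] marks the arcs of the cycle. Off the cycle [next p u] is [u], so [N u u] holds there; hence
   the condition [u != v] in [NM]. *)
pose N u v := next p u == v.
have NM u v : u != v -> N u v -> arc u v.
  move=> nuv /eqP huv; rewrite -huv; apply: next_cycle => //.
  by apply: contraR nuv => /negbTE nup; rewrite -huv next_nth nup.
pose M' : 'M[bool]_n := (\matrix_(i, j)
  ((M i j && ~~ N (inl i) (inr j)) || N (inr j) (inl i)))%R.
(* An additive form, free of truncated subtraction. Summed over a line of the matrix, both [N] terms
   give the membership of that line in [p], so they cancel. *)
have M'E i j :
  (M' i j : nat) + N (inl i) (inr j) = (M i j : nat) + N (inr j) (inl i).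
  rewrite mxE.
  have := @NM (inl i) (inr j) isT; have := @NM (inr j) (inl i) isT => /=.
  case: (M i j); case: (N _ _); case: (N _ _) => //= h1 h2.
  - by have := h1 isT.
  - by have := h2 isT.
  - by have := h2 isT.
have Nsym u v : N u v = (prev p v == u).
  by rewrite /N; apply/eqP/eqP => <-; rewrite ?prev_next ?next_prev.
have outL i : \sum_(j < n) (N (inl i) (inr j) : nat) = (inl i \in p).
  case: (boolP (inl i \in p)) => ip; last first.
    by rewrite big1 // => j _; rewrite /N next_nth (negbTE ip).
  have := next_cycle cp ip; rewrite /N.
  by case: (next p (inl i)) => [//|j0] _; exact: (sum_eq1 j0).
have outR j : \sum_(i < n) (N (inr j) (inl i) : nat) = (inr j \in p).
  case: (boolP (inr j \in p)) => ip; last first.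
    by rewrite big1 // => i _; rewrite /N next_nth (negbTE ip).
  have := next_cycle cp ip; rewrite /N.
  by case: (next p (inr j)) => [i0|//] _; exact: (sum_eq1 i0).
have inL i : \sum_(j < n) (N (inr j) (inl i) : nat) = (inl i \in p).
  case: (boolP (inl i \in p)) => ip; last first.
    by rewrite big1 // => j _; rewrite Nsym prev_nth (negbTE ip).
  have := prev_cycle cp ip; under eq_bigr do rewrite Nsym.
  by case: (prev p (inl i)) => [//|j0] _; exact: (sum_eq1 j0).
have inR j : \sum_(i < n) (N (inl i) (inr j) : nat) = (inr j \in p).
  case: (boolP (inr j \in p)) => ip; last first.
    by rewrite big1 // => i _; rewrite Nsym prev_nth (negbTE ip).
  have := prev_cycle cp ip; under eq_bigr do rewrite Nsym.
  by case: (prev p (inr j)) => [i0|//] _; exact: (sum_eq1 i0).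
exists M'; split.
- rewrite inE; apply/andP; split; apply/forallP => i; apply/eqP.
  + have: \sum_(j < n) ((M' i j : nat) + N (inl i) (inr j)) =
          \sum_(j < n) ((M i j : nat) + N (inr j) (inl i)).
      by apply: eq_bigr => j _; exact: M'E.
    by rewrite !big_split /= outL inL hr => /addIn.
  + have: \sum_(j < n) ((M' j i : nat) + N (inl j) (inr i)) =
          \sum_(j < n) ((M j i : nat) + N (inr i) (inl j)).
      by apply: eq_bigr => j _; exact: M'E.
    by rewrite !big_split /= outR inR hc => /addIn.
- have [u up'] : exists u, u \in p.
    by case: (p) p0 => // u s _; exists u; exact: mem_head.
  have := next_cycle cp up'; have := eqxx (next p u); rewrite -{1}/(N _ _).
  case: u up' => [i|j] _; case: (next _ _) => [i'|j'] //= Nuv Muv;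
    apply/eqP => /matrixP h.
  + have := M'E i j'; rewrite h Nuv => /addnI /esym/eqP; rewrite eqb1.
    by move=> /(NM (inr j') (inl i) isT) /=; rewrite Muv.
  + have := M'E i' j; rewrite h Nuv => /addnI /eqP; rewrite eqb1.
    by move=> /(NM (inl i') (inr j) isT) /=; rewrite (negbTE Muv).
- move=> i j; have := M'E i j; rewrite -/(N _ _) -/(N _ _).
  by case: (M' i j); case: (M i j); case: (N _ _); case: (N _ _).
Qed.

(** A free path back would close a cycle, simple after shortening, and switching it would give
    another matrix of [Lambda n x] containing [D]. *)
Lemma defining_acyclic D u v :
  defining_set x M D -> free_arc D u v -> ~~ connect (free_arc D) v u.
Proof.
move=> /and3P[ML /subsetP sDM /forallP dM] fuv.
apply/negP => /connectP[p0 pp0 lp0].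
case/shortenP: pp0 lp0 => p pp up _ lp.
have cp : cycle (free_arc D) (v :: p) by rewrite /= rcons_path pp -lp.
have cp' := sub_cycle (@free_arcW D) cp.
have [M' [M'L M'M hM']] := switch_cycle ML up cp' isT.
have := dM M'; rewrite M'L (negbTE M'M) implybF /= => /negP; apply.
have nf w w' : next (v :: p) w == w' -> w != w' -> free_arc D w w'.
  move=> /eqP hw nww; rewrite -hw; apply: next_cycle => //.
  by apply: contraR nww => /negbTE nin; rewrite -hw next_nth nin.
apply/subsetP => t tD; have /imset2P[i j _ _ tE] := sDM _ tD.
apply/imset2P; exists i j => //; rewrite tE in tD *; congr (_, _, _).
apply/eqP; rewrite eq_sym; apply: contraT => /hM'.
case: ifPn tD => [Mij|/negbTE Mij] tD /nf /(_ isT) /=.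
  by rewrite tD andbF.
by rewrite tD andbF.
Qed.

(** The sum of [(M' i j - M i j) * (rho (inr j) - rho (inl i))] vanishes because the margins agree,
    yet no term is positive, and outside [D] a term is zero only where [M'] and [M] agree. *)
Lemma acyclic_defining (rho : vertex -> nat) (D : {set 'I_n * 'I_n * bool}) :
    M \in Lambda n x -> D \subset triples M ->
    (forall u v, free_arc D u v -> rho u < rho v) ->
  defining_set x M D.
Proof.
move=> ML sDM hrho; rewrite /defining_set ML sDM /=.
apply/forall_inP => M' M'L; apply/implyP => /subsetP sDM'.
have /LambdaP[hr hc] := ML.
have [hr' hc'] : (forall i, \sum_(j < n) (M' i j : nat) = x) /\
                 (forall j, \sum_(i < n) (M' i j : nat) = x).
  move: M'L; rewrite inE => /andP[/forallP h1 /forallP h2].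
  by split=> i; apply/eqP.
have inD i j : (i, j, M i j) \in D -> M' i j = M i j.
  by move=> /sDM' /imset2P[i' j' _ _ [-> -> ->]].
pose L i := rho (inl i); pose R j := rho (inr j).
have le i j : (M' i j) * R j + (M i j) * L i <= (M i j) * R j + (M' i j) * L i
          ?= iff (M' i j == M i j).
  case: (boolP ((i, j, M i j) \in D)) => [/inD ->|nD].
    by rewrite eqxx; exact/leqif_refl.
  move: nD; case: (boolP (M i j)) => Mij nD.
    have := hrho (inl i) (inr j); rewrite /= Mij nD => /(_ isT) lt.
    case: (M' i j); rewrite !(mul0n, mul1n, addn0, add0n).
      by apply/leqif_refl.
    by rewrite /=; split; rewrite /L /R; lia.
  have := hrho (inr j) (inl i); rewrite /= Mij nD => /(_ isT) lt.
  case: (M' i j); rewrite !(mul0n, mul1n, addn0, add0n).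
    by rewrite /=; split; rewrite /L /R; lia.
  by apply/leqif_refl.
have sumE (A : 'M[bool]_n) (B : 'M[bool]_n) :
    (forall i, \sum_(j < n) (B i j : nat) = x) ->
    (forall j, \sum_(i < n) (A i j : nat) = x) ->
  \sum_(i < n) \sum_(j < n) ((A i j) * R j + (B i j) * L i) =
  x * (\sum_(j < n) R j) + x * (\sum_(i < n) L i).
  move=> hB hA; under eq_bigr do rewrite big_split /=.
  rewrite big_split /= exchange_big /= !big_distrr /=; congr (_ + _).
    by apply: eq_bigr => j _; rewrite -big_distrl /= hA.
  by apply: eq_bigr => i _; rewrite -big_distrl /= hB.
have le2 i := leqif_sum (P := xpredT) (fun j _ => le i j).
have := leqif_sum (P := xpredT) (fun i _ => le2 i).
rewrite (sumE M M') // (sumE M' M) //.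
case=> _; rewrite eqxx => /esym/forall_inP hh; apply/eqP/matrixP => i j.
by have /forall_inP/(_ j isT)/eqP := hh i isT.
Qed.

Lemma exists_critical (D0 : {set 'I_n * 'I_n * bool}) :
  defining_set x M D0 -> exists2 D, critical_set x M D & D \subset D0.
Proof.
move=> dD0; have [D /minsetP[dD minD] sD] := minset_exists dD0.
exists D => //; rewrite /critical_set dD /=.
apply/forallP => D'; apply/implyP => pD; apply: contraL pD => dD'.
rewrite properE; case: (boolP (D' \subset D)) => //= /(minD _ dD') ->.
by rewrite subxx.
Qed.

(** The entries whose arcs do not increase [rho] form a defining set [D0]. A critical subset of it
    leaves all increasing arcs free, so an entry of [B] missing from it would close a free cycle. *)
Lemma critical_of_rank (rho : vertex -> nat) (B : {set 'I_n * 'I_n}) :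
    M \in Lambda n x ->
    (forall i j, (i, j) \in B ->
       if M i j then connect (forward_arc rho) (inr j) (inl i)
       else connect (forward_arc rho) (inl i) (inr j)) ->
  exists2 D, critical_set x M D & #|B| <= #|D|.
Proof.
move=> ML hB.
pose D0 := [set t in triples M |
  ~~ (if M t.1.1 t.1.2 then rho (inl t.1.1) < rho (inr t.1.2)
      else rho (inr t.1.2) < rho (inl t.1.1))].
have tM i j : (i, j, M i j) \in triples M by apply/imset2P; exists i j.
have dD0 : defining_set x M D0.
  apply: (@acyclic_defining rho) => //.
    by apply/subsetP => t; rewrite inE => /andP[].
  move=> [i|j] [i'|j'] //= /andP[Mij]; rewrite inE /= ?Mij ?(negbTE Mij).
    by move: (tM i j'); rewrite Mij => -> /=; rewrite negbK.
  by move: (tM i' j); rewrite (negbTE Mij) => -> /=; rewrite negbK.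
have [D cD sD] := exists_critical dD0; exists D => //.
have dD : defining_set x M D by case/andP: cD.
have sub u v : connect (forward_arc rho) u v -> connect (free_arc D) u v.
  apply: connect_sub => {}u {}v /andP[auv ruv]; apply: connect1.
  case: u v auv ruv => [i|j] [i'|j'] //= Mij r; rewrite Mij /=;
    apply/negP => /(subsetP sD); rewrite inE /= ?Mij ?(negbTE Mij) r andbF //.
have -> : #|B| = #|[set (p.1, p.2, M p.1 p.2) | p in B]|.
  by rewrite card_imset // => -[i j] [i' j'] /= [-> ->].
apply/subset_leq_card/subsetP => _ /imsetP[[i j] /hB h ->] /=.
apply: contraT; case: ifP h => Mij /sub h nD.
  have := defining_acyclic (u := inl i) (v := inr j) dD.
  by rewrite /= Mij nD h => /(_ isT).
have := defining_acyclic (u := inr j) (v := inl i) dD.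
by rewrite /= Mij nD h => /(_ isT).
Qed.

End Orientation.

(** * Cauchy-Schwarz and the count of 4-cycles *)

Lemma sum_sqr_le (I : finType) (A : {pred I}) (f : I -> nat) :
  (\sum_(i in A) f i) ^ 2 <= #|A| * \sum_(i in A) f i ^ 2.
Proof.
have : \sum_(i in A) \sum_(j in A) 2 * (f i * f j) <=
       \sum_(i in A) \sum_(j in A) (f i ^ 2 + f j ^ 2).
  by apply: leq_sum => i _; apply: leq_sum => j _; apply: nat_Cauchy.
under eq_bigr do rewrite -big_distrr -big_distrr /=.
rewrite -big_distrr /= -big_distrl /= mulnn.
under [X in _ <= X]eq_bigr do rewrite big_split /= sum_nat_const.
by rewrite big_split /= -big_distrr /= sum_nat_const -mulnn; lia.
Qed.

(* Sidorenko's inequality for the 4-cycle. *)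
Lemma count_C4 (I J : finType) (A : {pred I}) (B : {pred J})
    (e : I -> J -> nat) :
  (\sum_(i in A) \sum_(j in B) e i j) ^ 4 <=
  (#|A| * #|B|) ^ 2 *
  \sum_(i in A) \sum_(j in B) \sum_(i' in A) \sum_(j' in B)
     e i j * e i j' * (e i' j * e i' j').
Proof.
set S := \sum_(i in A) _.
(* The codegree of [j] and [j']. Cauchy-Schwarz is applied over [i] for [hS], then over [j] and over
   [j'] for [hT]. *)
pose cod j j' := \sum_(i in A) e i j * e i j'.
pose T := \sum_(j in B) \sum_(j' in B) cod j j'.
have hS : S ^ 2 <= #|A| * T.
  apply: leq_trans (sum_sqr_le _ _) _; rewrite leq_mul2l; apply/orP; right.
  rewrite /T /cod; under [X in _ <= X]eq_bigr do rewrite exchange_big /=.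
  rewrite exchange_big /=; apply: leq_sum => i _; rewrite -mulnn big_distrl /=.
  by apply: leq_sum => j _; rewrite big_distrr.
have hT : T ^ 2 <= #|B| ^ 2 * \sum_(j in B) \sum_(j' in B) cod j j' ^ 2.
  apply: leq_trans (sum_sqr_le _ _) _; rewrite -mulnn -mulnA leq_mul2l.
  apply/orP; right; rewrite big_distrr /=; apply: leq_sum => j _.
  exact: sum_sqr_le.
have -> : \sum_(i in A) \sum_(j in B) \sum_(i' in A) \sum_(j' in B)
     e i j * e i j' * (e i' j * e i' j') =
  \sum_(j in B) \sum_(j' in B) cod j j' ^ 2.
  rewrite exchange_big /=; apply: eq_bigr => j _.
  under eq_bigr do rewrite exchange_big /=.
  rewrite exchange_big /=; apply: eq_bigr => j' _.
  rewrite -mulnn /cod big_distrl /=; apply: eq_bigr => i _.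
  by rewrite big_distrr.
have -> : S ^ 4 = (S ^ 2) ^ 2 by rewrite -expnM.
apply: leq_trans (_ : (#|A| * T) ^ 2 <= _); first by rewrite leq_exp2r.
by rewrite !expnMn -mulnA leq_mul2l hT orbT.
Qed.

(** * Exchange and double counting in balanced matrices *)

Lemma card_pairs (I J : finType) (P : I -> J -> bool) :
  #|[set p : I * J | P p.1 p.2]| = \sum_i \sum_j (P i j : nat).
Proof.
rewrite -sum1_card big_mkcond /= pair_big /=.
by apply: eq_bigr => p _; rewrite inE; case: (P _ _).
Qed.

Section Balanced.
Variables (n m : nat) (M : 'M[bool]_n).
Hypothesis ML : M \in Lambda n m.

Let row_sum i : \sum_(j < n) (M i j : nat) = m.
Proof. by have /LambdaP[] := ML. Qed.

Let col_sum j : \sum_(i < n) (M i j : nat) = m.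
Proof. by have /LambdaP[] := ML. Qed.

Lemma row_exchange r v :
  #|[set j | M v j && ~~ M r j]| = #|[set j | M r j && ~~ M v j]|.
Proof.
have h a b :
  #|[set j | M a j && ~~ M b j]| + \sum_(j < n) (M a j && M b j : nat) = m.
  rewrite -[RHS](row_sum a) -sum1_card big_mkcond -big_split /=.
  by apply: eq_bigr => j _; rewrite inE; case: (M a j); case: (M b j).
have := h v r; rewrite -(h r v); under eq_bigr do rewrite andbC.
exact: addIn.
Qed.

(** Supplies the path [r -> c' -> v] used to close 4-cycles. *)
Lemma row_exchange1 r v j : M v j -> ~~ M r j -> exists c', M r c' && ~~ M v c'.
Proof.
move=> vj rj.
have : 0 < #|[set k | M r k && ~~ M v k]|.
  by rewrite -row_exchange; apply/card_gt0P; exists j; rewrite inE vj.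
by case/card_gt0P => c'; rewrite inE; exists c'.
Qed.

Definition links (r c : 'I_n) : nat :=
  \sum_(i < n) \sum_(j < n) ([&& M i j, M i c & M r j] : nat).

Lemma links_le r c : links r c <= m ^ 2.
Proof.
rewrite -mulnn -{1}(col_sum c) big_distrl /=; apply: leq_sum => i _.
rewrite -(row_sum i) big_distrr /=; apply: leq_sum => j _.
by case: (M i j); case: (M i c); case: (M r j).
Qed.

Hypothesis nE : n = 2 * m.

(** Both counts complete [X] to [m ^ 2]: one over the [m] rows with a 1 in column [c], the other
    over the [m] columns with a 0 in row [r]. *)
Lemma links_compl r c :
  \sum_(i < n) \sum_(j < n) ([&& M i j, ~~ M i c & ~~ M r j] : nat) = links r c.
Proof.
pose X := \sum_(i < n) \sum_(j < n) ([&& M i j, M i c & ~~ M r j] : nat).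
have h1 : links r c + X = m * m.
  rewrite -{1}(col_sum c) big_distrl /= -big_split /=; apply: eq_bigr => i _.
  rewrite -(row_sum i) big_distrr /= -big_split /=; apply: eq_bigr => j _.
  by case: (M i j); case: (M i c); case: (M r j).
suff : \sum_(i < n) \sum_(j < n) ([&& M i j, ~~ M i c & ~~ M r j] : nat) + X
       = m * m.
  by rewrite -h1 => /addIn.
have hm : \sum_(j < n) (~~ M r j : nat) = m.
  have : \sum_(j < n) (~~ M r j : nat) + \sum_(j < n) (M r j : nat) = n.
    rewrite -big_split /= (eq_bigr (fun=> 1)).
      by rewrite sum1_card card_ord.
    by move=> j _; case: (M r j).
  by rewrite row_sum; lia.
rewrite -{1}hm big_distrl /= /X -big_split /=.
under eq_bigr do rewrite -big_split /=.
rewrite exchange_big /=; apply: eq_bigr => j _.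
rewrite -(col_sum j) big_distrr /=; apply: eq_bigr => i _.
by case: (M i j); case: (M i c); case: (M r j).
Qed.

Lemma card_unlinked r c :
  #|[set p | M p.1 p.2 && ~~ (M p.1 c && M r p.2)]| + links r c = 2 * m ^ 2.
Proof.
rewrite (card_pairs (fun i j => M i j && ~~ (M i c && M r j))) -big_split /=.
rewrite (eq_bigr (fun=> m)) ?sum_nat_const ?card_ord ?nE -?mulnn ?mulnA //.
move=> i _; rewrite -big_split -[RHS](row_sum i) /=; apply: eq_bigr => j _.
by case: (M i j); case: (M i c); case: (M r j).
Qed.

End Balanced.

Lemma Lambda_tr n x (M : 'M[bool]_n) :
  M \in Lambda n x -> (M^T)%R \in Lambda n x.
Proof.
move=> /LambdaP[hr hc]; apply/LambdaP; split=> i.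
  by under eq_bigr do rewrite mxE.
by under eq_bigr do rewrite mxE.
Qed.

Lemma col_exchange1 n m (M : 'M[bool]_n) c w i :
  M \in Lambda n m -> M i w -> ~~ M i c -> exists r', M r' c && ~~ M r' w.
Proof.
move=> /Lambda_tr MtL h1 h2.
have := @row_exchange1 _ m _ MtL c w i; rewrite !mxE => /(_ h1 h2)[r'].
by rewrite !mxE; exists r'.
Qed.

(** Every forced arc below closes a 4-cycle, so three increasing arcs always suffice. *)
Lemma connect3 (T : finType) (e : rel T) a b c d :
  e a b -> e b c -> e c d -> connect e a d.
Proof.
move=> ab bc cd; apply: connect_trans (connect1 ab) _.
exact: connect_trans (connect1 bc) (connect1 cd).
Qed.

(** * The two rankings and the entries they force *)

Section Configurations.
Variables (n m : nat) (M : 'M[bool]_n).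
Hypotheses (ML : M \in Lambda n m) (nE : n = 2 * m).

Lemma critical_unlinked r c : M r c ->
  exists2 D, critical_set m M D & 2 * m ^ 2 <= #|D| + links M r c.
Proof.
move=> rc.
(* The values 3 and 4 stay vacant; [critical_square] puts [y] and [z] there. *)
pose rho (u : 'I_n + 'I_n) := match u with
  | inl i => if i == r then 1 else if M i c then 5 else 7
  | inr j => if j == c then 6 else if M r j then 2 else 0
  end.
have rho_r : rho (inl r) = 1 by rewrite /= eqxx.
have rho_c : rho (inr c) = 6 by rewrite /= eqxx.
have rho_R1 i : M i c -> i != r -> rho (inl i) = 5 by move=> /= -> /negbTE ->.
have rho_R0 i : ~~ M i c -> rho (inl i) = 7.
  move=> nic; rewrite /= (negbTE nic); case: eqP => // ir.
  by rewrite ir rc in nic.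
have rho_C1 j : M r j -> j != c -> rho (inr j) = 2 by move=> /= -> /negbTE ->.
have rho_C0 j : ~~ M r j -> rho (inr j) = 0.
  move=> nrj; rewrite /= (negbTE nrj); case: eqP => // jc.
  by rewrite jc rc in nrj.
have fw := (rho_r, rho_c).
have [|D cD hD] := @critical_of_rank _ _ _ rho
    [set p | M p.1 p.2 && ~~ (M p.1 c && M r p.2)] ML; last first.
  by exists D => //; rewrite -(card_unlinked ML nE r c) leq_add2r.
move=> i j; rewrite inE /= => /andP[ij]; rewrite ij.
case: (boolP (M i c)) => ic; case: (boolP (M r j)) => rj //= _.
- have ir : i != r by apply: contraNneq rj => <-.
  have [c' /andP[rc' ic']] := row_exchange1 ML ij rj.
  have c'c : c' != c by apply: contraNneq ic' => ->.
  apply: (@connect3 _ _ _ (inl r) (inr c')); rewrite /forward_arc.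
  + by rewrite fw rho_C0 //= rj.
  + by rewrite fw rho_C1 //= rc'.
  + by rewrite rho_C1 // rho_R1 //= ic'.
- have [v /andP[vc vj]] := col_exchange1 ML ij ic.
  have jc : j != c by apply: contraNneq ic => <-.
  have vr : v != r by apply: contraNneq vj => ->.
  apply: (@connect3 _ _ _ (inl v) (inr c)); rewrite /forward_arc.
  + by rewrite rho_C1 // rho_R1 //= vj.
  + by rewrite fw rho_R1 //= vc.
  + by rewrite fw rho_R0 //= ic.
- apply: (@connect3 _ _ _ (inl r) (inr c)); rewrite /forward_arc.
  + by rewrite fw rho_C0 //= rj.
  + by rewrite !fw /= rc.
  + by rewrite fw rho_R0 //= ic.
Qed.

(** These 1-entries are among those counted by [links M r c], hence disjoint from the ones forced in
    [critical_unlinked]. *)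
Definition squares (r c y z : 'I_n) : nat :=
  \sum_(i < n) \sum_(j < n)
    ([&& M i j, M i c, ~~ M i z, M r j & ~~ M y j] : nat).

Lemma sum_row_indicator a (F : pred 'I_n) :
  \sum_(i < n) \sum_(j < n) ((i == a) && F j : nat) = \sum_(j < n) (F j : nat).
Proof.
rewrite (bigD1 a) //= [X in _ + X]big1 ?addn0; last first.
  by move=> i /negbTE ia; rewrite big1 // => j _; rewrite ia.
by rewrite eqxx.
Qed.

Lemma sum_col_indicator b (F : pred 'I_n) :
  \sum_(i < n) \sum_(j < n) ((j == b) && F i : nat) = \sum_(i < n) (F i : nat).
Proof. by rewrite exchange_big sum_row_indicator. Qed.

Lemma sum_point a b :
  \sum_(i < n) \sum_(j < n) ((i == a) && (j == b) : nat) = 1.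
Proof.
rewrite (sum_row_indicator a (pred1 b)) (bigD1 b) //= eqxx big1 // => j.
by move=> /negbTE ->.
Qed.

(** Row [r] is split by row [y]: squares in row [r] and forced entries lost in row [y] total [m]
    ([rows]). Columns [c] and [z] cost another [m] ([cols]). *)
Lemma card_linked_squares r c y z : M r c -> ~~ M y c -> M y z -> ~~ M r z ->
  2 * m ^ 2 + squares r c y z + 2 <=
  #|[set p : 'I_n * 'I_n | let: (i, j) := p in
     [|| (i == y) && (j == c), (i == r) && (j == z),
         [&& i != r, j != c & [&& M i j, M i c, ~~ M i z, M r j & ~~ M y j]] |
         [&& M i j, ~~ (M i c && M r j), ~~ ((i == y) && M r j),
             ~~ ((j == z) && M i c) & ~~ ((i == y) && (j == z))]]]|
  + links M r c + 2 * m.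
Proof.
move=> rc yc yz rz; have /LambdaP[row_sum col_sum] := ML.
set B := [set _ | _].
pose b i j := (i, j) \in B.
have -> : #|B| = \sum_(i < n) \sum_(j < n) (b i j : nat).
  by rewrite -card_pairs; apply: eq_card => -[i j]; rewrite inE.
have ones : \sum_(i < n) \sum_(j < n) (M i j : nat) = 2 * m ^ 2.
  under eq_bigr do rewrite row_sum.
  by rewrite sum_nat_const card_ord nE -mulnn mulnA.
have rows : \sum_(i < n) \sum_(j < n) ((i == y) && (M y j && M r j) : nat) +
            \sum_(i < n) \sum_(j < n) ((i == r) && (M r j && ~~ M y j) : nat)
            = m.
  rewrite (sum_row_indicator y (fun j => M y j && M r j)).
  rewrite (sum_row_indicator r (fun j => M r j && ~~ M y j)).
  rewrite -[RHS](row_sum r) -big_split /=; apply: eq_bigr => j _.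
  by case: (M r j); case: (M y j).
have cols : \sum_(i < n) \sum_(j < n) ((j == z) && (M i z && M i c) : nat) +
            \sum_(i < n) \sum_(j < n) ((j == c) && (M i c && ~~ M i z) : nat)
            = m.
  rewrite (sum_col_indicator z (fun j => M j z && M j c)).
  rewrite (sum_col_indicator c (fun j => M j c && ~~ M j z)).
  rewrite -[RHS](col_sum c) -big_split /=; apply: eq_bigr => j _.
  by case: (M j c); case: (M j z).
pose S (F : 'I_n -> 'I_n -> bool) := \sum_(i < n) \sum_(j < n) (F i j : nat).
(* An entrywise inequality. [(r, c)] is subtracted in both [rows] and [cols], hence restored on the
   left; this offsets the loss of [(y, z)]. The remaining gain of 2 is [(y, c)] and [(r, z)]. *)
suff : S (fun i j => M i j) + squares r c y z
     + S (fun i j => (i == y) && (j == c)) + S (fun i j => (i == r) && (j == z))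
     + S (fun i j => (i == r) && (j == c))
  <= S b + links M r c
     + S (fun i j => (i == y) && (M y j && M r j))
     + S (fun i j => (i == r) && (M r j && ~~ M y j))
     + S (fun i j => (j == z) && (M i z && M i c))
     + S (fun i j => (j == c) && (M i c && ~~ M i z))
     + S (fun i j => (i == y) && (j == z)).
  rewrite /S ones !sum_point; move: rows cols; set s1 := \sum_(i < n) _.
  set s2 := \sum_(i < n) _; set s3 := \sum_(i < n) _.
  by set s4 := \sum_(i < n) _; lia.
rewrite /S /links /squares -!big_split /=; apply: leq_sum => i _.
rewrite -!big_split /=; apply: leq_sum => j _; rewrite /b inE.
have ry : (r == y) = false by apply: contraNF yc => /eqP <-.
have cz : (c == z) = false by apply: contraNF rz => /eqP <-.
case: (eqVneq i r) => [->|ir]; [|case: (eqVneq i y) => [->|iy]];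
  (case: (eqVneq j c) => [->|jc]; [|case: (eqVneq j z) => [->|jz]]);
  rewrite ?ry ?cz ?[y == r]eq_sym ?[z == c]eq_sym ?ry ?cz ?eqxx ?rc ?yz
    ?(negbTE yc) ?(negbTE rz) ?(negbTE ir) ?(negbTE iy)
    ?(negbTE jc) ?(negbTE jz) //=;
  do [case: (M r j)]; do [case: (M y j)]; do [case: (M i c)];
  do [case: (M i z)]; do [case: (M i j)] => //.
Qed.

(** The extra vertices give increasing paths [r -> c2 -> y] (ranks 1, 2, 3) and [z -> v2 -> c]
    (ranks 4, 5, 6), where [c] and [r] have the wrong rank to be the middle vertex. *)
Lemma critical_square r c y z c2 v2 :
    M r c -> ~~ M y c -> M y z -> ~~ M r z ->
    c2 != c -> M r c2 -> ~~ M y c2 -> v2 != r -> M v2 c -> ~~ M v2 z ->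
  exists2 D, critical_set m M D &
    2 * m ^ 2 + squares r c y z + 2 <= #|D| + links M r c + 2 * m.
Proof.
move=> rc yc yz rz c2c rc2 yc2 v2r v2c v2z.
pose rho (u : 'I_n + 'I_n) := match u with
  | inl i => if i == r then 1 else if i == y then 3 else if M i c then 5 else 7
  | inr j => if j == c then 6 else if j == z then 4 else if M r j then 2 else 0
  end.
have rho_r : rho (inl r) = 1 by rewrite /= eqxx.
have rho_c : rho (inr c) = 6 by rewrite /= eqxx.
have rho_y : rho (inl y) = 3.
  by rewrite /= eqxx; case: eqP => // yr; rewrite yr rc in yc.
have rho_z : rho (inr z) = 4.
  by rewrite /= eqxx; case: eqP => // zc; rewrite zc rc in rz.
have rho_R1 i : M i c -> i != r -> rho (inl i) = 5.
  move=> ic /negbTE /= ->; rewrite ic; case: eqP => // iy.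
  by rewrite iy (negbTE yc) in ic.
have rho_R0 i : ~~ M i c -> i != y -> rho (inl i) = 7.
  move=> nic /negbTE /= ->; rewrite /= (negbTE nic); case: eqP => // ir.
  by rewrite ir rc in nic.
have rho_C1 j : M r j -> j != c -> rho (inr j) = 2.
  move=> rj /negbTE /= ->; rewrite rj; case: eqP => // jz.
  by rewrite jz (negbTE rz) in rj.
have rho_C0 j : ~~ M r j -> j != z -> rho (inr j) = 0.
  move=> nrj /negbTE /= ->; rewrite /= (negbTE nrj); case: eqP => // jc.
  by rewrite jc rc in nrj.
have fw := (rho_r, rho_c, rho_y, rho_z).
have := card_linked_squares rc yc yz rz; set B := [set _ | _] => hB.
have [|D cD hD] := @critical_of_rank _ _ _ rho B ML; last first.
  by exists D => //; apply: leq_trans hB _; rewrite !leq_add2r.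
move=> i j; rewrite inE.
case/or4P=> [/andP[/eqP -> /eqP ->]|/andP[/eqP -> /eqP ->]||].
- rewrite (negbTE yc).
  apply: (@connect3 _ _ _ (inr z) (inl v2)); rewrite /forward_arc.
  + by rewrite !fw /= yz.
  + by rewrite fw rho_R1 //= v2z.
  + by rewrite fw rho_R1 //= v2c.
- rewrite (negbTE rz).
  apply: (@connect3 _ _ _ (inr c2) (inl y)); rewrite /forward_arc.
  + by rewrite !fw rho_C1 //= rc2.
  + by rewrite fw rho_C1 //= yc2.
  + by rewrite !fw /= yz.
- case/and3P=> ir jc /and5P[ij ic iz rj yj]; rewrite ij.
  apply: (@connect3 _ _ _ (inl y) (inr z)); rewrite /forward_arc.
  + by rewrite !fw rho_C1 //= yj.
  + by rewrite !fw /= yz.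
  + by rewrite fw rho_R1 //= iz.
case/and5P=> ij; rewrite ij.
case: (boolP (M i c)) => ic; case: (boolP (M r j)) => rj //= _; rewrite ?andbT.
- move=> _ jz _.
  have ir : i != r by apply: contraNneq rj => <-.
  have [c' /andP[rc' ic']] := row_exchange1 ML ij rj.
  have c'c : c' != c by apply: contraNneq ic' => ->.
  apply: (@connect3 _ _ _ (inl r) (inr c')); rewrite /forward_arc.
  + by rewrite fw rho_C0 //= rj.
  + by rewrite fw rho_C1 //= rc'.
  + by rewrite rho_C1 // rho_R1 //= ic'.
- move=> iy _ _.
  have [v /andP[vc vj]] := col_exchange1 ML ij ic.
  have jc : j != c by apply: contraNneq ic => <-.
  have vr : v != r by apply: contraNneq vj => ->.
  apply: (@connect3 _ _ _ (inl v) (inr c)); rewrite /forward_arc.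
  + by rewrite rho_C1 // rho_R1 //= vj.
  + by rewrite fw rho_R1 //= vc.
  + by rewrite fw rho_R0 //= ic.
(* The path [j -> r -> c -> i] is not increasing if [i] is [y], below [c], or [j] is [z], above [r];
   [c2] and [v2] provide the detours. *)
- move=> _ _; case: (eqVneq i y) => [->|iy]; case: (eqVneq j z) => [->|jz] // _.
  + apply: (@connect3 _ _ _ (inl r) (inr c2)); rewrite /forward_arc.
    * by rewrite fw rho_C0 //= rj.
    * by rewrite !fw rho_C1 //= rc2.
    * by rewrite fw rho_C1 //= yc2.
  + apply: (@connect3 _ _ _ (inl v2) (inr c)); rewrite /forward_arc.
    * by rewrite fw rho_R1 //= v2z.
    * by rewrite fw rho_R1 //= v2c.
    * by rewrite fw rho_R0 //= ic.
  + apply: (@connect3 _ _ _ (inl r) (inr c)); rewrite /forward_arc.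
    * by rewrite fw rho_C0 //= rj.
    * by rewrite !fw /= rc.
    * by rewrite fw rho_R0 //= ic.
Qed.

(** The rows with a 0 in column [z] and the columns with a 0 in row [y] span an [m] by [m] block
    with [g] ones, by [links_compl]. It has at least [g ^ 4 / m ^ 4] 4-cycles, degenerate ones
    included, so some 1-entry lies on at least the average [g ^ 3 / m ^ 4]. *)
Lemma exists_rich_edge y z : 0 < links M y z ->
  exists r c, [/\ M r c, ~~ M r z, ~~ M y c &
                  links M y z ^ 3 <= m ^ 4 * squares r c y z].
Proof.
set g := links M y z => g0.
have /LambdaP[row_sum col_sum] := ML.
pose A := [pred i | ~~ M i z]; pose B := [pred j | ~~ M y j].
have cA : #|A| = m.
  have : #|A| + \sum_(i < n) (M i z : nat) = n.
    rewrite -sum1_card big_mkcond -big_split /= (eq_bigr (fun=> 1)).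
      by rewrite sum1_card card_ord.
    by move=> i _; rewrite inE; case: (M i z).
  by rewrite col_sum; lia.
have cB : #|B| = m.
  have : #|B| + \sum_(j < n) (M y j : nat) = n.
    rewrite -sum1_card big_mkcond -big_split /= (eq_bigr (fun=> 1)).
      by rewrite sum1_card card_ord.
    by move=> i _; rewrite inE; case: (M y i).
  by rewrite row_sum; lia.
have gE : \sum_(i in A) \sum_(j in B) (M i j : nat) = g.
  rewrite /g -(links_compl ML nE) big_mkcond; apply: eq_bigr => i _.
  rewrite inE; case: (boolP (M i z)) => iz /=.
    by rewrite big1 // => j _; rewrite andbF.
  rewrite big_mkcond; apply: eq_bigr => j _.
  by rewrite inE; case: (M i j); case: (M y j).
have := count_C4 A B (fun i j => M i j : nat); rewrite gE cA cB => hC4.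
pose good r c :=
  [&& M r c, ~~ M r z, ~~ M y c & g ^ 3 <= m ^ 4 * squares r c y z].
case: (boolP [exists r, [exists c, good r c]]) => [|nex].
  by case/existsP=> r /existsP[c /and4P h]; exists r, c.
suff : m ^ 4 * \sum_(r in A) \sum_(c in B) \sum_(i in A) \sum_(j in B)
     M r c * M r j * (M i c * M i j) < g ^ 4.
  have -> : m ^ 4 = (m * m) ^ 2 by rewrite mulnn -expnM.
  by rewrite ltnNge hC4.
(* If every 1-entry of the block fell short, the total would be at most [g * (g ^ 3).-1], below
   [g ^ 4] as [g] is positive. *)
apply: leq_ltn_trans (_ : \sum_(r in A) \sum_(c in B) M r c * (g ^ 3).-1 < _).
  rewrite big_distrr /=; apply: leq_sum => r rA.
  rewrite big_distrr /=; apply: leq_sum => c cB'.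
  case: (boolP (M r c)) => rc; last first.
    by rewrite big1 ?muln0 // => i _; rewrite big1 // => j _; rewrite mul0n.
  rewrite mul1n; rewrite !inE in rA cB'.
  have : ~~ good r c.
    apply: contraNN nex => h; apply/existsP; exists r.
    by apply/existsP; exists c.
  rewrite /good rc rA cB' /= -ltnNge => lt.
  (* For a 1-entry [(r, c)] of the block, [squares] counts its completions to a 4-cycle of the
     block. *)
  suff <- : squares r c y z =
      \sum_(i in A) \sum_(j in B) 1 * M r j * (M i c * M i j).
    by move: lt; case: (g ^ 3).
  rewrite /squares [RHS]big_mkcond; apply: eq_bigr => i _.
  rewrite inE; case: (boolP (M i z)) => iz /=.
    by rewrite big1 // => j _; rewrite !andbF.
  rewrite [RHS]big_mkcond; apply: eq_bigr => j _.
  by rewrite inE; case: (M i j); case: (M y j); case: (M r j); case: (M i c).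
under eq_bigr do rewrite -big_distrl /=.
rewrite -big_distrl /= gE [g ^ 4]expnS ltn_pmul2l //.
by rewrite prednK // expn_gt0 g0.
Qed.

(** All squares then lie in column [c]. By contraposition, more than [m] squares yield the column
    [c2] of [critical_square]. *)
Lemma squares_le_col r c y z :
  (forall j, M r j -> ~~ M y j -> j = c) -> squares r c y z <= m.
Proof.
move=> h; have /LambdaP[_ col_sum] := ML; rewrite -(col_sum c).
rewrite -[X in _ <= X](sum_col_indicator c (fun i => M i c)).
apply: leq_sum => i _; apply: leq_sum => j _.
case: and5P => //= -[_ -> _ rj yj].
by rewrite (h j rj yj) eqxx.
Qed.

Lemma squares_le_row r c y z :
  (forall i, M i c -> ~~ M i z -> i = r) -> squares r c y z <= m.
Proof.
move=> h; have /LambdaP[row_sum _] := ML; rewrite -(row_sum r).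
rewrite -[X in _ <= X](sum_row_indicator r (fun j => M r j)).
apply: leq_sum => i _; apply: leq_sum => j _.
case: and5P => //= -[_ ic iz -> _].
by rewrite (h i ic iz) eqxx.
Qed.

End Configurations.

(** * Numerical inequalities *)

Lemma tangent_cube t g : 3 * t ^ 2 * g <= g ^ 3 + 2 * t ^ 3.
Proof.
(* The difference of the sides is [(g - t) ^ 2 * (g + 2 * t)], expanded in either order of [g] and
   [t]. *)
case: (leqP g t) => [/subnKC|/ltnW /subnKC] <-; set d := _ - _.
  have -> : g ^ 3 + 2 * (g + d) ^ 3 =
            3 * (g + d) ^ 2 * g + d ^ 2 * (3 * g + 2 * d).
    by rewrite !expnS !expn0; lia.
  exact: leq_addr.
have -> : (t + d) ^ 3 + 2 * t ^ 3 = 3 * t ^ 2 * (t + d) + d ^ 2 * (3 * t + d).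
  by rewrite !expnS !expn0; lia.
exact: leq_addr.
Qed.

(** Otherwise [(m + 2) ^ 3 <= 8 * m ^ 2], which never holds. *)
Lemma lt_of_cube_bound m g h :
  0 < m -> m ^ 2 + 2 * m <= 2 * g -> g ^ 3 <= m ^ 4 * h -> m < h.
Proof.
move=> m0 hg hh; rewrite ltnNge; apply/negP => hm.
have h1 : (m * (m + 2)) ^ 3 <= (2 * g) ^ 3.
  by rewrite leq_exp2r //; move: hg; rewrite -mulnn; lia.
have h2 : m ^ 4 * h <= m ^ 4 * m by rewrite leq_mul2l hm orbT.
have : m ^ 3 * (m + 2) ^ 3 <= m ^ 3 * (8 * m ^ 2).
  rewrite -expnMn; apply: leq_trans h1 _; rewrite expnMn.
  have -> : m ^ 3 * (8 * m ^ 2) = 8 * (m ^ 4 * m) by rewrite !expnS expn0; lia.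
  by rewrite leq_mul2l /=; exact: leq_trans hh h2.
rewrite leq_pmul2l ?expn_gt0 ?m0 // leqNgt => /negP; apply.
case: m m0 {hg hh hm h1 h2} => // k _.
have -> : (k.+1 + 2) ^ 3 = 8 * k.+1 ^ 2 + (k * k * k.+1 + 11 * k + 19).
  by rewrite !expnS !expn0; lia.
by rewrite -[X in X < _]addn0 ltn_add2l addnS.
Qed.

(* The tangent to [g ^ 3] at [g = 3 m ^ 2 / 5] suffices: it leaves
   [27 m ^ 2 + 500 <= 230 m], of negative discriminant. *)
Lemma tangent_bound m g h : 0 < m ->
  m ^ 2 + 2 * m <= 2 * g -> g ^ 3 <= m ^ 4 * h ->
  2 * g + 2 * m <= m ^ 2 + 3 + 2 * h.
Proof.
move=> m0 hg hh; rewrite leqNgt; apply/negP => lt.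
have h1 : 2 * g ^ 3 + m ^ 4 * (m ^ 2 + 4) <= m ^ 4 * (2 * g + 2 * m).
  have : m ^ 4 * (m ^ 2 + 4 + 2 * h) <= m ^ 4 * (2 * g + 2 * m).
    by rewrite leq_mul2l; apply/orP; right; lia.
  by rewrite mulnDr; lia.
have h2 : m ^ 4 * (135 * g) <= 125 * g ^ 3 + 54 * (m ^ 4 * m ^ 2).
  have := tangent_cube (3 * m ^ 2) (5 * g).
  rewrite !expnS !expn0 !muln1; lia.
(* Adding 125 times [h1] to twice [h2] cancels [g ^ 3]. *)
have : m ^ 4 * (20 * g + 17 * m ^ 2 + 500) <= m ^ 4 * (250 * m).
  by move: h1 h2; set a := m ^ 4; set b := m ^ 2; rewrite !mulnDr; lia.
rewrite leq_pmul2l ?expn_gt0 ?m0 //; move: hg; rewrite -mulnn.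
move=> hg' le; have {le}le : 27 * (m * m) + 500 <= 230 * m by lia.
(* From 9 on, [27 * m ^ 2] is at least [243 * m]; the smaller values are checked singly. *)
case: (leqP 9 m) => [/(leq_mul (leqnn m))|]; first by lia.
by move: le; clear; do 9![case: m => [|m]; first by lia]; lia.
Qed.

(** * The dichotomy on the least number of links *)

Theorem theorem18 (m : nat) (hm : 1 <= m) :
  uphalf (3 * m ^ 2 - 2 * m + 1) <= supLambda (2 * m) m
  /\ (forall M : 'M[bool]_(2 * m), M \in Lambda (2 * m) m ->
        exists D : {set 'I_(2 * m) * 'I_(2 * m) * bool},
          critical_set m M D /\ uphalf (3 * m ^ 2 - 2 * m + 1) <= #|D|).
Proof.
have size_unlinked d a : 2 * m ^ 2 <= d + a -> 2 * a < m ^ 2 + 2 * m ->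
    uphalf (3 * m ^ 2 - 2 * m + 1) <= d.
  (* This makes the subtraction in [3 * m ^ 2 - 2 * m] exact. *)
  have : m <= m ^ 2 by rewrite -mulnn leq_pmulr.
  by rewrite leq_uphalf_double; lia.
have size_square d a g h : 2 * m ^ 2 + h + 2 <= d + a + 2 * m -> a <= g ->
    2 * g + 2 * m <= m ^ 2 + 3 + 2 * h -> uphalf (3 * m ^ 2 - 2 * m + 1) <= d.
  have : m <= m ^ 2 by rewrite -mulnn leq_pmulr.
  by rewrite leq_uphalf_double; lia.
have main (M : 'M[bool]_(2 * m)) : M \in Lambda (2 * m) m ->
    exists D, critical_set m M D /\ uphalf (3 * m ^ 2 - 2 * m + 1) <= #|D|.
  move=> ML; have /LambdaP[row_sum col_sum] := ML.
  have nE : 2 * m = 2 * m by [].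
  pose one (p : 'I_(2 * m) * 'I_(2 * m)) := M p.1 p.2.
  case: (boolP [exists p, one p && (2 * links M p.1 p.2 < m ^ 2 + 2 * m)]).
    case/existsP => -[r c] /andP[/= rc hrc].
    have [D cD hD] := critical_unlinked ML nE rc.
    by exists D; split => //; exact: size_unlinked hD hrc.
  move=> /existsPn many.
  have {}many i j : M i j -> m ^ 2 + 2 * m <= 2 * links M i j.
    by move=> ij; have := many (i, j); rewrite /one /= ij /= -leqNgt.
  have [p0 op0] : exists p, one p.
    have i0 : 'I_(2 * m) by apply: (@Ordinal _ 0); lia.
    have /existsP[j ij] : [exists j, M i0 j].
      apply: contraLR hm => /existsPn h; rewrite -(row_sum i0) big1 // => j _.
      by rewrite (negbTE (h j)).
    by exists (i0, j).
  (* Maximality will bound [links M r c] by [links M y z] for the pair [(r, c)] found next. *)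
  have [[y z] /= yz ymax] := arg_maxnP (fun p => links M p.1 p.2) op0.
  have gy := many y z yz.
  have [|r [c [rc rz yc hh]]] := @exists_rich_edge _ m M ML nE y z.
    by lia.
  have hm' := lt_of_cube_bound hm gy hh.
  have [c2 /and3P[c2c rc2 yc2]] : exists c2, [&& c2 != c, M r c2 & ~~ M y c2].
    apply/existsP; apply: contraLR hm' => /existsPn h; rewrite -leqNgt.
    apply: (squares_le_col ML) => j rj yj; apply/eqP; have := h j.
    by rewrite rj yj !andbT negbK.
  have [v2 /and3P[v2r v2c v2z]] : exists v2, [&& v2 != r, M v2 c & ~~ M v2 z].
    apply/existsP; apply: contraLR hm' => /existsPn h; rewrite -leqNgt.
    apply: (squares_le_row ML) => i ic iz; apply/eqP; have := h i.
    by rewrite ic iz !andbT negbK.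
  have [D cD hD] := critical_square ML nE rc yc yz rz c2c rc2 yc2 v2r v2c v2z.
  have hr : links M r c <= links M y z by exact: (ymax (r, c) rc).
  exists D; split => //.
  exact: size_square hD hr (tangent_bound hm gy hh).
split=> //.
have [M ML ->] := supLambda_attained (Lambda_double_neq0 m).
have [D [cD hD]] := main M ML; apply: leq_trans hD _.
exact: (@bigmax_sup _ D).
Qed.
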